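(* Let $m,n$ be positive integers and let $q$ be an integer with $\gcd(q,m)=1$. Then $$U^{(q)}_l(m,n)=\sum_{0<i\le\lfloor m/2\rfloor}(-1)^{i-1}a_m(i)\,U^{(q)}_{l-i}(m,n)\quad\text{for all integers } l\ge\left\lfloor\frac m2\right\rfloor,$$ and, provided $\gcd(q,2m)=1$, $$V^{(q)}_l(m,n)=\sum_{j=1}^{\lfloor (m+1)/2\rfloor}(-1)^{j-1}b_m(j)\,V^{(q)}_{l-j}(m,n)\quad\text{for all integers } l\ge\left\lfloor\frac{m+1}2\right\rfloor,$$ where the integers $a_m(i)$ and $b_m(j)$ are given by $$a_m(i)=\begin{cases}c_m(i)&\text{if } 2\mid m,\\ d_m(i)&\text{if } 2\nmid m,\end{cases}\qquad b_m(j)=\begin{cases}d_m(j)&\text{if } 2\mid m,\\ c_m(j)&\text{if } 2\nmid m.\end{cases}$$ If $m$ does not divide $n$, and $p$ is an odd prime with $p\equiv q$ or $p\equiv -q\pmod{2m}$, then $$(-1)^{\lfloor pn/m\rfloor}E_{p-2}\left(\left\{\frac{pn}{m}\right\}\right)+\frac{2^p-2}{p}\equiv\frac mp\left(V^{(q)}_p(m,n)-1\right)\pmod p.$$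
   Context: For positive integers $m,n$, an integer $q$ with $\gcd(q,m)=1$, and an integer $l\ge 0$, define $$U^{(q)}_l(m,n)=\frac1{2m}\sum_{\substack{\gamma^m=1\\ \gamma\ne1}}\frac{2-\gamma^{qn}-\gamma^{-qn}}{2-\gamma^q-\gamma^{-q}}\,(2-\gamma-\gamma^{-1})^l,$$ the sum being over complex $m$-th roots of unity $\gamma\neq 1$ (the denominators are nonzero since $\gcd(q,m)=1$). When $\gcd(q,2m)=1$, define also $$V^{(q)}_l(m,n)=\frac1{2m}\sum_{\gamma^m=-1}\frac{2-\gamma^{qn}-\gamma^{-qn}}{2-\gamma^q-\gamma^{-q}}\,(2-\gamma-\gamma^{-1})^l,$$ the sum being over all complex $\gamma$ with $\gamma^m=-1$. For $i=0,\ldots,m-1$, $$c_m(i)=\frac{m^2+m-2i}{(m-i)(m+1-i)}\binom{m+1-i}{i},\qquad d_m(i)=\frac{m}{m-i}\binom{m-i}{i},$$ and in addition $c_1(1)=4$. The Euler polynomials $E_k(x)$ are given by $\dfrac{2e^{xz}}{e^z+1}=\sum_{k=0}^\infty E_k(x)\dfrac{z^k}{k!}$. $\lfloor\alpha\rfloor$ and $\{\alpha\}=\alpha-\lfloor\alpha\rfloor$ denote the integral and fractional parts of a real number $\alpha$. A congruence modulo $p$ between rational numbers means that their difference is $p$ times a rational number whose denominator is prime to $p$. *)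

(* Defs.v *)
From mathcomp Require Import all_boot all_order all_algebra.
From mathcomp Require Import all_classical all_reals.
From mathcomp Require Export complex.

Set Implicit Arguments.
Unset Strict Implicit.
Unset Printing Implicit Defensive.

Import Order.TTheory GRing.Theory Num.Theory.

Local Open Scope ring_scope.
Local Open Scope classical_set_scope.
Local Open Scope complex_scope.

Section RootOfUnitySums.
Variable R : realType.

Definition summand (q : int) (l n : nat) (g : R[i]) : R[i] :=
  (2 - g ^ (q * n%:Z) - g ^ (- (q * n%:Z))) / (2 - g ^ q - g ^ (- q))
  * (2 - g - g^-1) ^+ l.

Definition Usum (q : int) (l m n : nat) : R[i] :=
  (2 * m%:R)^-1 *
  \sum_(g \in [set g : R[i] | g ^+ m = 1 /\ g <> 1]) summand q l n g.

Definition Vsum (q : int) (l m n : nat) : R[i] :=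
  (2 * m%:R)^-1 *
  \sum_(g \in [set g : R[i] | g ^+ m = -1]) summand q l n g.

End RootOfUnitySums.

(* Only used for i < m, and for (m, i) = (1, 1) in the case of coef_c, so that
   m - i never truncates and the denominators are nonzero. *)
Definition coef_c (m i : nat) : rat :=
  if (m == 1%N) && (i == 1%N) then 4
  else (m%:R ^+ 2 + m%:R - 2 * i%:R) / ((m%:R - i%:R) * (m%:R + 1 - i%:R))
       * 'C(m.+1 - i, i)%:R.

Definition coef_d (m i : nat) : rat :=
  m%:R / (m%:R - i%:R) * 'C(m - i, i)%:R.

Definition coef_a (m i : nat) : rat :=
  if (2 %| m)%N then coef_c m i else coef_d m i.

Definition coef_b (m j : nat) : rat :=
  if (2 %| m)%N then coef_d m j else coef_c m j.

(* A formal power series in z is represented by its sequence of coefficients. *)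

Section FormalSeries.
Variable A : comUnitRingType.
Implicit Types f g h : nat -> A.

Definition fps_one : nat -> A := fun k => (k == 0%N)%:R.

Definition fps_add f g : nat -> A := fun k => f k + g k.

Definition fps_mul f g : nat -> A :=
  fun k => \sum_(i < k.+1) f i * g (k - i)%N.

(* The first k.+1 coefficients of 1 / f, meaningful when f 0 is a unit. *)
Fixpoint fps_inv_seq f (k : nat) : seq A :=
  if k is k'.+1 then
    let s := fps_inv_seq f k' in
    rcons s (- ((f 0%N)^-1 * \sum_(i < k) f i.+1 * s`_(k' - i)))
  else [:: (f 0%N)^-1].

Definition fps_inv f : nat -> A := fun k => (fps_inv_seq f k)`_k.

Lemma size_fps_inv_seq f k : size (fps_inv_seq f k) = k.+1.
Proof. by elim: k => //= k IH; rewrite size_rcons IH. Qed.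

Lemma nth_fps_inv_seq f k j :
  (j <= k)%N -> (fps_inv_seq f k)`_j = fps_inv f j.
Proof.
elim: k => [|k IH]; first by rewrite leqn0 => /eqP ->.
rewrite leq_eqVlt => /orP[/eqP -> //|jk].
by rewrite /= nth_rcons size_fps_inv_seq jk IH.
Qed.

Lemma fps_mulV f k :
  f 0%N \is a GRing.unit -> fps_mul f (fps_inv f) k = fps_one k.
Proof.
move=> f0; case: k => [|k]; first by rewrite /fps_mul big_ord1 /= divrr.
rewrite /fps_mul big_ord_recl subn0 {1}/fps_inv /= nth_rcons.
rewrite size_fps_inv_seq ltnn eqxx mulrN mulrA divrr // mul1r.
rewrite (eq_bigr (fun i : 'I_k.+1 => f i.+1 * fps_inv f (k - i))).
  by rewrite addNr.
by move=> i _; rewrite nth_fps_inv_seq // leq_subr.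
Qed.

Lemma fps_mulC f g k : fps_mul f g k = fps_mul g f k.
Proof.
rewrite /fps_mul (reindex_inj rev_ord_inj) /=; apply: eq_bigr => i _.
by rewrite subSS subKn 1?mulrC // -ltnS.
Qed.

Lemma eq_fps_mul f f' g g' : f =1 f' -> g =1 g' -> fps_mul f g =1 fps_mul f' g'.
Proof. by move=> ff' gg' k; apply: eq_bigr => i _; rewrite ff' gg'. Qed.

Lemma fps_mul1 f k : fps_mul f fps_one k = f k.
Proof.
rewrite /fps_mul big_ord_recr /= subnn /fps_one eqxx mulr1 big1 ?add0r // => i _.
by rewrite subn_eq0 leqNgt ltn_ord mulr0.
Qed.

Lemma coef_fps_mul f g N k : (k < N)%N ->
  (\poly_(i < N) f i * \poly_(i < N) g i)`_k = fps_mul f g k.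
Proof.
move=> kN; rewrite coefM; apply: eq_bigr => i _; rewrite !coef_poly.
rewrite (leq_ltn_trans _ kN) ?(leq_ltn_trans _ kN) ?leq_subr //.
by rewrite -ltnS.
Qed.

Lemma fps_mulA f g h k :
  fps_mul f (fps_mul g h) k = fps_mul (fps_mul f g) h k.
Proof.
pose P (u : nat -> A) := \poly_(i < k.+1) u i.
have PM u v i : (i <= k)%N -> (P (fps_mul u v))`_i = (P u * P v)`_i.
  by move=> ik; rewrite coef_poly ltnS ik coef_fps_mul.
rewrite -!(@coef_fps_mul _ _ k.+1) // -/(P _) -/(P h) -/(P f).
transitivity ((P f * (P g * P h))`_k).
  rewrite coefM [RHS]coefM; apply: eq_bigr => i _.
  by rewrite PM ?leq_subr.
rewrite mulrA coefM [RHS]coefM; apply: eq_bigr => i _.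
by rewrite PM // -ltnS.
Qed.

End FormalSeries.

(* e^(u z), a power series in z with coefficients in rat[X]. *)
Definition fps_exp (u : {poly rat}) : nat -> {poly rat} :=
  fun k => (k`!%:R)^-1 *: u ^+ k.

(* k! times the coefficient of z^k in 2 e^(X z) / (e^z + 1). *)
Definition euler (k : nat) : {poly rat} :=
  k`!%:R *: fps_mul (fun j => 2 * fps_exp 'X j)
                    (fps_inv (fps_add (fps_exp 1) (@fps_one _))) k.

Lemma euler_gf k :
  fps_mul (fps_add (fps_exp 1) (@fps_one _))
          (fun j => (j`!%:R)^-1 *: euler j) k
  = 2 * fps_exp 'X k.
Proof.
set D := fps_add _ _.
have D0 : D 0%N \is a GRing.unit.
  rewrite /D /fps_add /fps_exp /fps_one /= fact0 invr1 scale1r expr0.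
  by rewrite -polyC1 -polyCD poly_unitE size_polyC coefC.
have E j : (j`!%:R)^-1 *: euler j
    = fps_mul (fps_inv D) (fun j => 2 * fps_exp 'X j) j.
  rewrite /euler scalerA mulVf; first by rewrite scale1r fps_mulC.
  by rewrite pnatr_eq0 -lt0n fact_gt0.
rewrite (eq_fps_mul (fun=> erefl) E) fps_mulA.
rewrite (eq_fps_mul (fun j => fps_mulV j D0) (fun=> erefl)).
by rewrite fps_mulC fps_mul1.
Qed.

Definition frac_part (x : rat) : rat := x - (Num.floor x)%:~R.

Definition eq_modp (p : nat) (x y : rat) : Prop :=
  exists r : rat, x - y = p%:R * r /\ coprimez (denq r) p%:Z.

(* Main.v *)
From HB Require Import structures.
Require Import Defs.
From mathcomp Require Import all_boot all_order all_algebra.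
From mathcomp Require Import cyclic separable cyclotomic finfield.
From mathcomp Require Import all_classical all_reals.
From mathcomp Require Import ring lra zify.
Import Order.TTheory GRing.Theory Num.Theory.
Local Open Scope ring_scope.

(** Recurrences. Choose u with u ^ 2 = g and put y = u - 1/u, so that the
    quantity x = 2 - g - 1/g raised to the power l in both sums is - y ^ 2. The
    Fibonacci polynomials F_n(y) satisfy
      (u + 1/u) F_n(y) = u ^ (n+1) - (-1/u) ^ (n+1),
    hence the following two combinations vanish when g ^ m is a suitable sign:
      F_m(y) + F_(m-2)(y) = u ^ m + (-1/u) ^ m           (g ^ m = - (-1) ^ m),
      (y ^ 2 + 4) F_(m-1)(y) = (u + 1/u) (u ^ m - (-1/u) ^ m)  (g ^ m = (-1) ^ m).
    Their coefficients are d_m(i) and c_m(i), which shows that these are integers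
    ([coef_dE], [coef_cE]), and dividing out a possible odd factor y turns the
    vanishing into a linear recurrence for the powers of x ([chord_d],
    [chord_c]). Each root of unity thus contributes a sequence satisfying the
    recurrence, and the parity of m decides which of the two applies.

    Congruence. Since p = q or p = -q modulo 2m and every g is a 2m-th root of
    unity, q may be replaced by p. As p is odd, each term of V then becomes
      (2 - g ^ (pn) - g ^ (-pn)) * ((1 - g) ^ p / (1 - g ^ p)) ^ 2,
    where (1 - g) ^ p = 1 - g ^ p + p A(g) with integers A_k congruent to -1/k
    modulo p. The ratio is invariant under g -> 1/g, so the sum is twice that of
    (1 - g ^ (pn)) times the squared ratio, and expanding the square yields
      (m/p) (V - 1) = 2 T + (p/2) W,   W an integer,
      T = sum over g of (1 + g ^ p + ... + g ^ (p(n-1))) A(g)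
    ([sum_frob_ratio_eq], [Vsum_prime]). The sum of g ^ t over all g is (-1) ^ s m
    if t = s m, and 0 if m does not divide t. Modulo p the coefficient A_k of
    g ^ (pj + k) is -1/(pj + k), so T is minus the sum of (-1) ^ s / s over the s
    prime to p with s <= F = floor(pn/m), and 1/s is s ^ (p-2)
    ([frob_trace_modp]).

    On the other side, E_k(x+1) + E_k(x) = 2 x ^ k telescopes at negative
    integers to
      (-1) ^ F E_(p-2)(-F) - E_(p-2)(0) = -2 sum of (-1) ^ s s ^ (p-2), s <= F
    ([euler_alt_sum]). The fractional part of pn/m is -F plus p times the
    p-integral number n/m, and E_(p-2) has p-integral coefficients, so its value
    there is E_(p-2)(-F) modulo p. Taking F = p - 1 in the same identity
    identifies E_(p-2)(0) with -(2 ^ p - 2)/p modulo p ([euler0_fermat]), and all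
    the terms cancel ([euler_vsum_congr]). *)

Set Implicit Arguments.
Unset Strict Implicit.
Unset Printing Implicit Defensive.

(** * Fibonacci polynomials *)

Section Fibonacci.
Variable F : fieldType.
Implicit Types y u : F.

(** The Fibonacci polynomial of degree n. The truncated exponents are harmless:
    the binomial coefficient vanishes as soon as n < 2i. *)
Definition fib (n : nat) y : F :=
  \sum_(i < n.+1) 'C(n - i, i)%:R * y ^+ (n - i.*2).

Lemma fib0 y : fib 0 y = 1.
Proof. by rewrite /fib big_ord1 /= mulr1. Qed.

Lemma fib1 y : fib 1 y = y.
Proof. by rewrite /fib !big_ord_recl big_ord0 /= mul1r mul0r !addr0 expr1. Qed.

Lemma fibS n y : fib n.+2 y = y * fib n.+1 y + fib n y.
Proof.
rewrite {1}/fib big_ord_recl big_ord_recr /= /bump /= add1n subn0 bin0 mul1r.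
rewrite subnn bin0n mul0r addr0.
(* Pascal's rule splits each term into one of y * fib n.+1 and one of fib n. *)
rewrite (eq_bigr (fun i : 'I_n.+1 =>
  y * ('C(n - i, i.+1)%:R * y ^+ (n.+1 - i.+1.*2))
  + 'C(n - i, i)%:R * y ^+ (n - i.*2))); last first.
  move=> i _; rewrite add1n (_ : (n.+2 - i.+1)%N = (n - i).+1); last first.
    by have := ltn_ord i; lia.
  rewrite binS natrD mulrDl (_ : (n.+2 - i.+1.*2)%N = (n - i.*2)%N); last lia.
  congr (_ + _).
  have [le|gt] := leqP i.+1.*2 n.+1.
    by rewrite mulrCA -exprS; congr (_ * _ ^+ _); lia.
  by rewrite bin_small ?mul0r ?mulr0 //; lia.
rewrite big_split /= -mulr_sumr addrA; congr (_ + _).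
by rewrite [in RHS]/fib [in RHS]big_ord_recl /= subn0 bin0 mul1r mulrDr exprS.
Qed.

(** Binet's formula: u and -1/u are the roots of X ^ 2 - y X - 1. *)
Lemma fib_closed n u : u != 0 ->
  (u + u^-1) * fib n (u - u^-1) = u ^+ n.+1 - (- u^-1) ^+ n.+1.
Proof.
move=> u0.
suff [] : (u + u^-1) * fib n (u - u^-1) = u ^+ n.+1 - (- u^-1) ^+ n.+1
  /\ (u + u^-1) * fib n.+1 (u - u^-1) = u ^+ n.+2 - (- u^-1) ^+ n.+2 by [].
elim: n => [|n [IH0 IH1]]; first by rewrite fib0 fib1; split; ring.
split=> //; rewrite fibS mulrDr mulrCA IH0 IH1.
rewrite ![_ ^+ _.+3]exprS ![_ ^+ _.+2]exprS ![_ ^+ _.+1]exprS.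
by move: (u ^+ n) ((- u^-1) ^+ n) => a b; field.
Qed.

(** The Lucas analogue of Binet's formula. It is proved from the recursion and
    not from [fib_closed], which would require dividing by u + 1/u. *)
Lemma lucas_closed n u : u != 0 ->
  fib n.+2 (u - u^-1) + fib n (u - u^-1) = u ^+ n.+2 + (- u^-1) ^+ n.+2.
Proof.
move=> u0.
suff [] : fib n.+2 (u - u^-1) + fib n (u - u^-1)
    = u ^+ n.+2 + (- u^-1) ^+ n.+2
  /\ fib n.+3 (u - u^-1) + fib n.+1 (u - u^-1)
    = u ^+ n.+3 + (- u^-1) ^+ n.+3 by [].
elim: n => [|n [IH0 IH1]]; first by rewrite !fibS fib0 fib1; split; field.
split=> //; rewrite fibS [X in _ + X]fibS addrACA -mulrDr IH0 IH1.
rewrite ![_ ^+ _.+4]exprS ![_ ^+ _.+3]exprS ![_ ^+ _.+2]exprS.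
by move: (u ^+ n.+1) ((- u^-1) ^+ n.+1) => a b; field.
Qed.

Lemma sum_ord_trunc (f : nat -> F) K K' : (K <= K')%N ->
  (forall i, (K <= i)%N -> f i = 0) -> \sum_(i < K') f i = \sum_(i < K) f i.
Proof.
move=> KK f0; rewrite -!(big_mkord xpredT) (big_cat_nat (n := K)) //=.
rewrite [X in _ + X](_ : _ = 0) ?addr0 // big_nat big1 // => i /andP[Ki _].
exact: f0.
Qed.

Lemma fib_trunc n K y : (n < K.*2)%N ->
  fib n y = \sum_(i < K) 'C(n - i, i)%:R * y ^+ (n - i.*2).
Proof.
move=> nK; set f := fun i => 'C(n - i, i)%:R * y ^+ (n - i.*2).
have f0 i : (n < i.*2)%N -> f i = 0.
  by move=> ni; rewrite /f bin_small ?mul0r //; lia.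
rewrite -(@sum_ord_trunc f K (K + n.+1)) ?leq_addr //; last first.
  by move=> i Ki; apply: f0; lia.
by rewrite [RHS](@sum_ord_trunc f n.+1) ?leq_addl // => i ni; apply: f0; lia.
Qed.

End Fibonacci.

(** * The integers c_m(i) and d_m(i) *)

(** The coefficients of F_m + F_(m-2) and of (y ^ 2 + 4) F_(m-1). At i = 0 the
    second summand is absent, while i.-1 would truncate to 0; the factor (0 < i)
    removes it. *)
Definition d_nat (m i : nat) : nat :=
  'C(m - i, i) + (0 < i) * 'C((m - i).-1, i.-1).
Definition c_nat (m i : nat) : nat :=
  'C((m - i).-1, i) + 4 * (0 < i) * 'C(m - i, i.-1).

Lemma coef_dE m i : (i < m)%N -> coef_d m i = (d_nat m i)%:R.
Proof.
move=> im; rewrite /coef_d /d_nat.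
have a0 : ((m - i)%:R : rat) != 0 by rewrite pnatr_eq0; lia.
rewrite -natrB; last lia.
apply: (mulfI a0); rewrite mulrA mulrCA divff // mulr1 -!natrM; congr (_%:R).
case: i im a0 => [|i] im _; first by rewrite subn0 bin0 mul0n addn0.
by rewrite mul1n mulnDr mul_bin_diag -mulnDl subnK // ltnW.
Qed.

(** Apart from the exceptional value c_1(1): with a = m - i, both binomials are
    rational multiples of C(a+1, i); clearing denominators, the claim is
    (a+1-i)(a-i) + 4ia = (a+i) ^ 2 + (a+i) - 2i. *)
Lemma coef_cE m i : (0 < m)%N -> (0 < i <= m.+1 %/ 2)%N ->
  coef_c m i = (c_nat m i)%:R.
Proof.
move=> m0 /andP[i0 im]; rewrite /coef_c /c_nat.
have [/andP[/eqP-> /eqP->] //|mi1] := ifP.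
have mE : m = (m - i + i)%N by lia.
have a0 : (0 < m - i)%N by lia.
have ia : (i <= (m - i).+1)%N by lia.
rewrite i0 muln1.
move: (m - i)%N mE a0 ia => a -> a0 ia.
rewrite (_ : ((a + i).+1 - i)%N = a.+1); last lia.
rewrite natrD (_ : a%:R + i%:R - i%:R = a%:R) ?addrK //.
rewrite (_ : a%:R + i%:R + 1 - i%:R = a.+1%:R :> rat); last by rewrite -natr1; ring.
have b0 : (a%:R : rat) != 0 by rewrite pnatr_eq0; lia.
have c0 : (a.+1%:R : rat) != 0 by rewrite pnatr_eq0.
apply: (mulfI (mulf_neq0 b0 c0)); rewrite mulrA mulrCA divff ?mulf_neq0 // mulr1.
have E1 := congr1 (fun n => n%:R : rat) (mul_bin_down a i).
have E2 := congr1 (fun n => n%:R : rat) (mul_bin_down a.+1 i).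
have E3 := congr1 (fun n => n%:R : rat) (mul_bin_diag a.+1 i.-1).
(* Only a - i can truncate, and then i = a + 1 makes the other factor vanish. *)
have E4 : (a - i)%:R * (a.+1 - i)%:R * ('C(a.+1, i))%:R =
   (a%:R - i%:R) * (a.+1%:R - i%:R) * ('C(a.+1, i))%:R :> rat.
  move: ia; rewrite leq_eqVlt => /orP[/eqP->|ia].
    by rewrite subnn subrr !mulr0.
  by rewrite !natrB //; lia.
move: E1 E2 E3 E4; rewrite prednK // natrD !natrM mulrDr /=.
move: ('C(a.-1, i)%:R : rat) ('C(a, i)%:R : rat).
move: ('C(a.+1, i)%:R : rat) ('C(a, i.-1)%:R : rat).
move: ((a - i)%:R : rat) ((a.+1 - i)%:R : rat) => v1 v2 x3 x4 x1 x2 h1 h2 h3 h4.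
transitivity (a.+1%:R * (a%:R * x1) + 4 * a%:R * (a.+1%:R * x4)); last by ring.
rewrite h1 h3 (mulrCA _ v1) h2 [v1 * _]mulrA h4 -natr1.
by ring.
Qed.

Lemma sum_d_nat (F : fieldType) (y : F) n :
  \sum_(i < (n.+2 %/ 2).+1) (d_nat n.+2 i)%:R * y ^+ (n.+2 - i.*2)
  = fib n.+2 y + fib n y.
Proof.
rewrite (@fib_trunc _ n.+2 (n.+2 %/ 2).+1); last lia.
rewrite (@fib_trunc _ n (n.+2 %/ 2)); last lia.
under eq_bigr do rewrite natrD mulrDl.
rewrite big_split /=; congr (_ + _).
rewrite big_ord_recl /= mul0n mul0r add0r; apply: eq_bigr => i _.
by rewrite /bump /= add1n mul1n; congr ('C(_, _)%:R * _ ^+ _); lia.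
Qed.

Lemma sum_c_nat (F : fieldType) (y : F) n :
  \sum_(i < (n.+2 %/ 2).+1) (c_nat n.+1 i)%:R * y ^+ (n.+2 - i.*2)
  = (y ^+ 2 + 4) * fib n y.
Proof.
rewrite mulrDl {1}(@fib_trunc _ n (n.+2 %/ 2).+1); last lia.
rewrite (@fib_trunc _ n (n.+2 %/ 2)); last lia.
under eq_bigr do rewrite natrD mulrDl.
rewrite big_split /=; congr (_ + _).
  rewrite mulr_sumr; apply: eq_bigr => i _.
  rewrite mulrCA -exprD (_ : (n.+1 - i).-1 = n - i)%N; last lia.
  have [le|gt] := leqP i.*2 n; first by congr (_ * _ ^+ _); lia.
  by rewrite bin_small ?mul0r //; lia.
rewrite big_ord_recl /= mul0n mul0r add0r mulr_sumr; apply: eq_bigr => i _.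
rewrite /bump /= add1n muln1 natrM mulrA.
by congr (_ * _ * _ ^+ _); lia.
Qed.

(** * Recurrences for the powers of 2 - g - 1/g *)

(** A monic polynomial relation for w is a linear recurrence for the powers of
    -w; the alternating signs come from this change of sign. *)
Lemma chord_recurrence (F : fieldType) (c : nat -> F) K (x w : F) :
  x = - w -> c 0%N = 1 -> \sum_(i < K.+1) c i * w ^+ (K - i) = 0 ->
  forall l, (K <= l)%N ->
  x ^+ l = \sum_(1 <= i < K.+1) (-1) ^+ (i - 1) * c i * x ^+ (l - i).
Proof.
move=> xw c0 s0 l Kl.
have : (-1) ^+ K * x ^+ (l - K) * (\sum_(i < K.+1) c i * w ^+ (K - i)) = 0.
  by rewrite s0 mulr0.
rewrite mulr_sumr.
rewrite -(big_mkord xpredT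
  (fun i => (-1) ^+ K * x ^+ (l - K) * (c i * w ^+ (K - i)))).
rewrite (eq_big_nat _ _ (F2 := fun i => (-1) ^+ i * c i * x ^+ (l - i))); last first.
  move=> i iK; rewrite (_ : w = - x); last by rewrite xw opprK.
  rewrite -(mulN1r x) exprMn (_ : (l - i = (l - K) + (K - i))%N); last lia.
  rewrite exprD {1}(_ : K = (K - i + i)%N); last lia.
  rewrite exprD; have := sqrr_sign F (K - i); rewrite expr2 => e.
  transitivity ((-1) ^+ (K - i) * (-1) ^+ (K - i)
      * ((-1) ^+ i * c i * (x ^+ (l - K) * x ^+ (K - i)))); first by ring.
  by rewrite e mul1r.
rewrite big_ltn // expr0 c0 subn0 !mul1r => /eqP; rewrite addr_eq0 => /eqP ->.
rewrite -sumrN; apply: eq_big_nat => -[|i] // _.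
by rewrite subSS subn0 exprS !mulN1r !mulNr opprK.
Qed.

Section Chord.
Variable C : numClosedFieldType.
Implicit Types g : C.

Lemma chordE g : g != 0 -> g != 1 ->
  exists u : C, [/\ u != 0, u ^+ 2 = g, u - u^-1 != 0
    & 2 - g - g^-1 = - (u - u^-1) ^+ 2].
Proof.
move=> g0 g1; exists (sqrtC g); have u2 := sqrtCK g.
move: (sqrtC g) u2 => u u2; have u0 : u != 0.
  by apply: contraNneq g0 => u0; rewrite -u2 u0 expr0n.
split=> //; last by rewrite -u2; field.
apply: contraNneq g1 => /eqP; rewrite subr_eq0 => /eqP e.
by rewrite -u2 expr2 {2}e divff.
Qed.

Lemma chord_d m g l : (1 < m)%N -> g != 0 -> g != 1 -> g ^+ m = - (-1) ^+ m ->
  (m %/ 2 <= l)%N ->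
  (2 - g - g^-1) ^+ l = \sum_(1 <= i < (m %/ 2).+1)
     (-1) ^+ (i - 1) * (d_nat m i)%:R * (2 - g - g^-1) ^+ (l - i).
Proof.
move=> m1 g0 g1 gm; have [u [u0 u2 y0 ->]] := chordE g0 g1.
apply: (chord_recurrence (c := fun i => (d_nat m i)%:R) erefl).
  by rewrite /d_nat subn0 bin0.
case: m m1 gm => [|[|n]] // _ gm.
(* For odd m all exponents of y are odd: the superfluous factor y is nonzero. *)
apply: (mulfI (expf_neq0 (n.+2 %% 2)%N y0)); rewrite mulr0 mulr_sumr.
transitivity (\sum_(i < (n.+2 %/ 2).+1)
    (d_nat n.+2 i)%:R * (u - u^-1) ^+ (n.+2 - i.*2)).
  apply: eq_bigr => i _; rewrite mulrCA -exprM -exprD; congr (_ * _ ^+ _).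
  by have := ltn_ord i; lia.
rewrite sum_d_nat lucas_closed //; apply: (mulfI (expf_neq0 n.+2 u0)).
rewrite mulr0 mulrDr -[X in _ + X]exprMn mulrN divff // -exprD addnn -mul2n.
by rewrite exprM u2 gm addNr.
Qed.

Lemma chord_c m g l : (0 < m)%N -> g != 0 -> g != 1 -> g ^+ m = (-1) ^+ m ->
  (m.+1 %/ 2 <= l)%N ->
  (2 - g - g^-1) ^+ l = \sum_(1 <= i < (m.+1 %/ 2).+1)
     (-1) ^+ (i - 1) * (c_nat m i)%:R * (2 - g - g^-1) ^+ (l - i).
Proof.
move=> m1 g0 g1 gm; have [u [u0 u2 y0 ->]] := chordE g0 g1.
apply: (chord_recurrence (c := fun i => (c_nat m i)%:R) erefl).
  by rewrite /c_nat subn0 bin0.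
case: m m1 gm => [|n] // _ gm.
(* Here the exponents n.+2 - 2i of y are odd when n is, that is, when m is even. *)
apply: (mulfI (expf_neq0 (n.+2 %% 2)%N y0)); rewrite mulr0 mulr_sumr.
transitivity (\sum_(i < (n.+2 %/ 2).+1)
    (c_nat n.+1 i)%:R * (u - u^-1) ^+ (n.+2 - i.*2)).
  apply: eq_bigr => i _; rewrite mulrCA -exprM -exprD; congr (_ * _ ^+ _).
  by have := ltn_ord i; lia.
rewrite sum_c_nat (_ : _ + 4 = (u + u^-1) * (u + u^-1)); last by field.
rewrite -mulrA fib_closed //; apply: (mulfI (expf_neq0 n.+1 u0)).
rewrite mulr0 mulrCA mulrBr -[X in _ - X]exprMn mulrN divff // -exprD addnn.
by rewrite -mul2n exprM u2 gm subrr mulr0.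
Qed.

End Chord.

(** * Roots of unity and of -1 *)

Lemma ex_prim_root (C : numClosedFieldType) n : (0 < n)%N ->
  exists z : C, n.-primitive_root z.
Proof.
move=> n0; have [r] := closed_field_poly_normal ('X^n - 1 : {poly C}).
rewrite (monicP (monicXnsubC _ n0)) scale1r => Xn1.
have /hasP[z _ zn] : has n.-primitive_root r; last by exists z.
apply: has_prim_root => //.
- by apply/allP => z; rewrite -root_prod_XsubC -Xn1.
- by rewrite -separable_prod_XsubC -Xn1 separable_Xn_sub_1 // pnatr_eq0 -lt0n.
- by rewrite -ltnS -(size_prod_XsubC r id) -Xn1 size_XnsubC.
Qed.

(** The sum of the t-th powers of all m-th roots of -1, see [sum_odd_root]. *)
Definition root_trace (m t : nat) : int :=
  if (m %| t)%N then (-1) ^+ (t %/ m) * m%:Z else 0.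

(** The m-th roots of -1 are the odd powers of a primitive 2m-th root of 1. *)
Section OddRoots.
Variables (C : numClosedFieldType) (m : nat) (w : C).
Hypotheses (m_gt0 : (0 < m)%N) (w_prim : (m.*2).-primitive_root w).

Local Notation "'gam' k" := (w ^+ (k : nat).*2.+1) (at level 10).

Lemma prim_root_half : w ^+ m = -1.
Proof.
have : w ^+ m != 1 by rewrite -(prim_order_dvd w_prim) gtnNdvd //; lia.
have := prim_expr_order w_prim; rewrite -mul2n mulnC exprM => /eqP.
by rewrite sqrf_eq1 => /orP[/eqP->|/eqP//]; rewrite eqxx.
Qed.

Lemma odd_root_expm k : (gam k) ^+ m = -1.
Proof. by rewrite exprAC prim_root_half -signr_odd /= odd_double expr1. Qed.

Lemma odd_root_neq0 k : gam k != 0.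
Proof. by rewrite expf_neq0 // (prim_root_eq0 w_prim); lia. Qed.

Lemma odd_root_rev (k : 'I_m) : gam (rev_ord k) = (gam k)^-1.
Proof.
apply: (mulfI (odd_root_neq0 k)); rewrite divff ?odd_root_neq0 // -exprD.
rewrite (_ : _ + _ = m.*2)%N ?(prim_expr_order w_prim) //=.
by have := ltn_ord k; lia.
Qed.

Lemma sum_odd_root t : \sum_(k < m) (gam k) ^+ t = (root_trace m t)%:~R.
Proof.
have E k : (gam k) ^+ t = w ^+ t * (w ^+ t.*2) ^+ k.
  by rewrite -!exprM -exprD; congr (_ ^+ _); lia.
rewrite (eq_bigr (fun k : 'I_m => w ^+ t * (w ^+ t.*2) ^+ k)) => [|k _]; last exact: E.
rewrite -mulr_sumr /root_trace; have [mt|mt] := ifP.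
  have -> : w ^+ t = (-1) ^+ (t %/ m).
    by rewrite -{1}(divnK mt) mulnC exprM prim_root_half.
  have -> : w ^+ t.*2 = 1.
    by rewrite -mul2n mulnC exprM -{1}(divnK mt) mulnC exprM prim_root_half sqrr_sign.
  rewrite (eq_bigr (fun=> 1)) => [|i _]; last by rewrite expr1n.
  by rewrite sumr_const card_ord rmorphM /= rmorph_sign.
have w1 : w ^+ t.*2 - 1 != 0.
  by rewrite subr_eq0 -(prim_order_dvd w_prim) -!mul2n dvdn_pmul2l // mt.
apply/eqP; rewrite mulf_eq0; apply/orP; right; rewrite -(mulrI_eq0 _ (mulfI w1)).
rewrite -subrX1 -exprM mulnC -doubleMr doubleMl exprM (prim_expr_order w_prim).
by rewrite expr1n subrr.
Qed.

Lemma sum_odd_root_poly (P : {poly int}) :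
  exists z : int, \sum_(k < m) (map_poly intr P).[gam k] = z%:~R.
Proof.
exists (\sum_(i < size P) P`_i * root_trace m i).
under eq_bigr do rewrite (horner_coef_wide _ (size_poly _ _)).
rewrite exchange_big rmorph_sum; apply: eq_bigr => i _.
rewrite rmorphM /= -sum_odd_root mulr_sumr; apply: eq_bigr => k _.
by rewrite coef_map.
Qed.

End OddRoots.

(** * The recurrences for U and V *)

Section SumsOverRoots.
Variable R : realType.
Local Notation C := R[i]%C.
Implicit Types (q : int) (l m n : nat).

Local Open Scope classical_set_scope.

Lemma finite_unity_roots m : (0 < m)%N -> finite_set [set g : C | g ^+ m = 1].
Proof.
move=> m0; have [z zm] := ex_prim_root C m0.
apply: (@sub_finite_set _ _ [set` [seq z ^+ i | i <- iota 0 m]]); last exact: finite_seq.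
move=> g /= gm; have [i ->] := prim_rootP zm gm.
by apply: map_f; rewrite mem_iota /=.
Qed.

Lemma fsum_recurrence (A : set C) (a : C) (c : nat -> C) K q n :
  finite_set A ->
  (forall g, A g -> forall l, (K <= l)%N ->
     (2 - g - g^-1) ^+ l =
     \sum_(1 <= i < K.+1) (-1) ^+ (i - 1) * c i * (2 - g - g^-1) ^+ (l - i)) ->
  forall l, (K <= l)%N ->
  a * (\sum_(g \in A) summand q l n g) =
    \sum_(1 <= i < K.+1)
      (-1) ^+ (i - 1) * c i * (a * (\sum_(g \in A) summand q (l - i) n g)).
Proof.
move=> finA rec l Kl; rewrite !fsbig_finite //=.
under [RHS]eq_bigr do rewrite fsbig_finite //= mulrCA mulr_sumr.
rewrite -mulr_sumr exchange_big /=; congr (_ * _).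
rewrite big_seq [RHS]big_seq; apply: eq_bigr => g.
rewrite in_fset_set // => /set_mem /rec /(_ l Kl) gl.
rewrite /summand gl mulr_sumr; apply: eq_bigr => i _.
by rewrite mulrCA.
Qed.

Lemma Usum_recurrence q l m n : (0 < m)%N -> (m %/ 2 <= l)%N ->
  Usum R q l m n = \sum_(1 <= i < (m %/ 2).+1)
    (-1) ^+ (i - 1) * ratr (coef_a m i) * Usum R q (l - i) m n.
Proof.
move=> m0; apply: fsum_recurrence => [|g [gm /eqP g1] {}l ml].
  by apply: sub_finite_set (finite_unity_roots m0) => g [].
have g0 : g != 0.
  apply/eqP => g0; move/eqP: gm.
  by rewrite g0 expr0n eqn0Ngt m0 eq_sym oner_eq0.
rewrite /coef_a dvdn2; have [mo|me] /= := boolP (odd m).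
  have m1 : (1 < m)%N.
    case: m m0 gm {mo ml} => [|[|m]] //.
    by rewrite expr1 => _ /eqP; rewrite (negPf g1).
  rewrite (@chord_d _ m) //; last by rewrite -signr_odd mo expr1 opprK.
  by apply: eq_big_nat => i im; rewrite coef_dE ?ratr_nat //; lia.
have mE : (m.+1 %/ 2 = m %/ 2)%N by lia.
rewrite -mE in ml *; rewrite (@chord_c _ m) //; last by rewrite -signr_odd (negPf me).
by apply: eq_big_nat => i im; rewrite coef_cE ?ratr_nat.
Qed.

Lemma Vsum_recurrence q l m n : (0 < m)%N -> (m.+1 %/ 2 <= l)%N ->
  Vsum R q l m n = \sum_(1 <= j < (m.+1 %/ 2).+1)
    (-1) ^+ (j - 1) * ratr (coef_b m j) * Vsum R q (l - j) m n.
Proof.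
move=> m0; apply: fsum_recurrence => [|g /= gm {}l ml].
  apply: (@sub_finite_set _ _ [set g : C | g ^+ (m + m) = 1]).
    by move=> g /= gm; rewrite exprD gm mulrNN mulr1.
  by apply: finite_unity_roots; lia.
have g0 : g != 0.
  apply/eqP => g0; move/eqP: gm.
  by rewrite g0 expr0n eqn0Ngt m0 eq_sym oppr_eq0 oner_eq0.
have g1 : g != 1.
  apply/eqP => g1; move/eqP: gm; rewrite g1 expr1n -subr_eq0 opprK.
  by rewrite (_ : 1 + 1 = 2%:R) // pnatr_eq0.
rewrite /coef_b dvdn2; have [mo|me] /= := boolP (odd m).
  rewrite (@chord_c _ m) //; last by rewrite -signr_odd mo expr1.
  by apply: eq_big_nat => i im; rewrite coef_cE ?ratr_nat.
have mE : (m.+1 %/ 2 = m %/ 2)%N by lia.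
rewrite mE in ml *.
rewrite (@chord_d _ m) //; [|lia|by rewrite -signr_odd (negPf me)].
by apply: eq_big_nat => i im; rewrite coef_dE ?ratr_nat //; lia.
Qed.

Lemma Vsum_prim_root w q l m n : (0 < m)%N -> (m.*2).-primitive_root w ->
  Vsum R q l m n = (2 * m%:R)^-1 * \sum_(k < m) summand q l n (w ^+ k.*2.+1).
Proof.
move=> m0 wm; rewrite /Vsum; congr (_ * _).
rewrite -(big_mkord xpredT (fun k => summand q l n (w ^+ k.*2.+1))).
rewrite -(big_map (fun k => w ^+ k.*2.+1) xpredT (summand q l n)).
rewrite [RHS]fsbig_seq; last first.
  rewrite map_inj_in_uniq ?iota_uniq // => i j; rewrite !mem_index_iota => im jm /eqP.
  by rewrite (eq_prim_root_expr wm) !modn_small; lia.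
apply: eq_fsbigl; apply/seteqP; split => g /=.
  move=> gm; have [i ig] : {i : 'I_(m.*2) | g = w ^+ i}.
    by apply: (prim_rootP wm); rewrite -addnn exprD gm mulrNN mulr1.
  have io : odd i.
    apply/negPn/negP => ie; move/eqP: gm.
    rewrite ig exprAC (prim_root_half m0 wm) -signr_odd (negPf ie).
    by rewrite -subr_eq0 opprK (_ : 1 + 1 = 2%:R) // pnatr_eq0.
  apply/mapP; exists i./2; first by rewrite mem_index_iota; have := ltn_ord i; lia.
  by rewrite ig; congr (_ ^+ _); lia.
by move=> /mapP[k _ ->]; exact: odd_root_expm.
Qed.

End SumsOverRoots.

(** * The sum V with q = l = p prime *)

(** (1 - g) ^ p = 1 - g ^ p + p * (sum of the frob_quot p k * g ^ k). At k = 0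
    the truncating quotient gives 0, so that sums may start at 0. *)
Definition frob_quot (p k : nat) : int := (-1) ^+ k * ('C(p, k) %/ p)%:Z.

Definition frob_defect (A : nzRingType) (p : nat) (g : A) : A :=
  \sum_(k < p) (frob_quot p k)%:~R * g ^+ k.

Definition frob_ratio (C : fieldType) (p : nat) (g : C) : C :=
  (1 - g) ^+ p / (1 - g ^+ p).

Definition geom (A : nzRingType) (n : nat) (h : A) : A := \sum_(j < n) h ^+ j.

Lemma bin_prime_quot p k : prime p -> (k < p)%N ->
  'C(p, k) = ((k == 0) + p * ('C(p, k) %/ p))%N.
Proof.
move=> p_pr; case: k => [|k] kp.
  by rewrite bin0 divn_small ?prime_gt1 ?muln0.
by rewrite add0n mulnC divnK // prime_dvd_bin.
Qed.

Lemma expr_1subr (A : comNzRingType) p (g : A) : prime p -> odd p ->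
  (1 - g) ^+ p = 1 - g ^+ p + p%:R * frob_defect p g.
Proof.
move=> p_pr p_odd; rewrite exprBn big_ord_recr /= binn mulr1n expr1n mulr1.
rewrite -[X in X * g ^+ p]signr_odd p_odd expr1 mulN1r addrAC; congr (_ - _).
rewrite (eq_bigr (fun k : 'I_p => ((k : nat) == 0)%:R * g ^+ k
    + p%:R * ((frob_quot p k)%:~R * g ^+ k))); last first.
  move=> k _; rewrite expr1n mulr1 {1}(bin_prime_quot p_pr (ltn_ord k)) /frob_quot.
  rewrite -mulr_natr natrD natrM rmorphM /= rmorph_sign.
  rewrite -pmulrn; case: eqP => [->|_] /=; last by ring.
  by rewrite !expr0; ring.
rewrite big_split /= -mulr_sumr; congr (_ + _).
case: p p_pr {p_odd} => // p _.
by rewrite big_ord_recl /= mulr1 big1 ?addr0 // => i _; rewrite mul0r.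
Qed.

Section PowerOfPrime.
Variables (C : numClosedFieldType) (m : nat) (w : C).
Hypotheses (m_gt0 : (0 < m)%N) (w_prim : (m.*2).-primitive_root w).
Variables (p n : nat).
Hypotheses (p_pr : prime p) (p_odd : odd p).

Local Notation "'gam' k" := (w ^+ (k : nat).*2.+1) (at level 10).

Lemma odd_root_expp_neq1 k : (gam k) ^+ p != 1.
Proof.
apply/eqP => e; have := congr1 (fun z => z ^+ m) e.
rewrite /= exprAC (odd_root_expm m_gt0 w_prim) -signr_odd p_odd expr1 expr1n => /eqP.
by rewrite eq_sym -subr_eq0 opprK (_ : 1 + 1 = 2%:R) // pnatr_eq0.
Qed.

(** Since (g ^ p) ^ m = -1, inverting 1 - g ^ p costs only a factor 2, which is
    prime to p. *)
Lemma geom_odd_root k : geom m ((gam k) ^+ p) = 2 / (1 - (gam k) ^+ p).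
Proof.
have h1 : 1 - gam k ^+ p != 0 by rewrite subr_eq0 eq_sym odd_root_expp_neq1.
apply: (mulfI h1); rewrite mulrCA divff // mulr1 -opprB mulNr -subrX1.
rewrite [_ ^+ p ^+ m]exprAC (odd_root_expm m_gt0 w_prim) -signr_odd p_odd expr1.
by ring.
Qed.

Lemma frob_ratioE k (g := gam k) :
  frob_ratio p g = 1 + p%:R / 2 * frob_defect p g * geom m (g ^+ p).
Proof.
rewrite /frob_ratio expr_1subr // geom_odd_root.
by field; rewrite subr_eq0 eq_sym odd_root_expp_neq1.
Qed.

Lemma frob_ratioV k : frob_ratio p (gam k)^-1 = frob_ratio p (gam k).
Proof.
have h1 := odd_root_expp_neq1 k; have := odd_root_neq0 m_gt0 w_prim k.
move: (gam k) h1 => g h1 g0.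
have h1' : 1 - g ^+ p != 0 by rewrite subr_eq0 eq_sym.
have gp0 : g ^+ p != 0 by rewrite expf_neq0.
have e : (1 - g^-1) ^+ p = - (1 - g) ^+ p / g ^+ p.
  rewrite (_ : 1 - g^-1 = - ((1 - g) / g)); last by field.
  by rewrite exprNn -signr_odd p_odd expr1 mulN1r expr_div_n mulNr.
rewrite /frob_ratio e exprVn; field.
by rewrite h1' gp0 subr_eq0 h1.
Qed.

(** Symmetrizing by g -> 1/g leaves only nonnegative powers of g. *)
Lemma sum_frob_ratio :
  \sum_(k < m) (2 - (gam k) ^+ p ^+ n - (gam k) ^- p ^+ n)
    * frob_ratio p (gam k) ^+ 2
  = 2 * \sum_(k < m) (1 - (gam k) ^+ p ^+ n) * frob_ratio p (gam k) ^+ 2.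
Proof.
rewrite mulr_natl mulr2n [X in _ = X + _](reindex_inj rev_ord_inj) -big_split /=.
apply: eq_bigr => k _; rewrite (odd_root_rev m_gt0 w_prim) frob_ratioV !exprVn.
by ring.
Qed.

Lemma sum_geom_frob_defect :
  \sum_(k < m) geom n ((gam k) ^+ p) * frob_defect p (gam k) =
  (\sum_(j < n) \sum_(i < p) frob_quot p i * root_trace m (j * p + i))%:~R.
Proof.
rewrite rmorph_sum /=; under eq_bigr do rewrite mulr_suml.
rewrite exchange_big /=; apply: eq_bigr => j _.
rewrite rmorph_sum /=; under eq_bigr do rewrite mulr_sumr.
rewrite exchange_big /=; apply: eq_bigr => i _.
rewrite intrM -(sum_odd_root m_gt0 w_prim) mulr_sumr; apply: eq_bigr => k _.
by rewrite mulrCA -[_ ^+ p ^+ j]exprM -exprD mulnC.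
Qed.

(** With h = g ^ p, A = frob_defect, N = 1 + ... + h ^ (n-1) and
    G = 1 + ... + h ^ (m-1) = 2 / (1 - h), expanding the square gives
    (1 - h ^ n) (1 + (p/2) A G) ^ 2 = (1 - h ^ n) + 2 p N A + (p ^ 2 / 2) N A ^ 2 G. *)
Lemma sum_frob_ratio_eq : coprime p m -> ~~ (m %| n)%N ->
  exists W : int,
    \sum_(k < m) (1 - (gam k) ^+ p ^+ n) * frob_ratio p (gam k) ^+ 2 =
    m%:R
    + 2 * p%:R
      * (\sum_(j < n) \sum_(i < p) frob_quot p i * root_trace m (j * p + i))%:~R
    + p%:R ^+ 2 / 2 * W%:~R.
Proof.
move=> pm mn.
pose N : {poly int} := \sum_(j < n) 'X^(p * j).
pose G : {poly int} := \sum_(j < m) 'X^(p * j).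
pose A : {poly int} := \sum_(k < p) frob_quot p k *: 'X^k.
have [W We] := sum_odd_root_poly m_gt0 w_prim (N * A ^+ 2 * G); exists W.
have geomE l g : (map_poly intr (\sum_(j < l) 'X^(p * j))).[g] = geom l (g ^+ p) :> C.
  rewrite rmorph_sum horner_sum; apply: eq_bigr => j _.
  by rewrite /= map_polyXn hornerXn exprM.
have AE g : (map_poly intr A).[g] = frob_defect p g :> C.
  rewrite rmorph_sum horner_sum; apply: eq_bigr => j _.
  by rewrite /= map_polyZ map_polyXn hornerZ hornerXn.
rewrite -We -sum_geom_frob_defect [2 * _ * _]mulr_sumr [_ / 2 * _]mulr_sumr.
transitivity (\sum_(k < m) (1 - (gam k) ^+ (p * n)) +
   \sum_(k < m) 2 * p%:R * (geom n (gam k ^+ p) * frob_defect p (gam k)) +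
   \sum_(k < m) p%:R ^+ 2 / 2 * (map_poly intr (N * A ^+ 2 * G)).[gam k]); last first.
  congr (_ + _ + _); rewrite sumrB (sum_odd_root m_gt0 w_prim) sumr_const card_ord.
  by rewrite /root_trace Gauss_dvdr 1?coprime_sym // (negPf mn) subr0.
rewrite -!big_split /=; apply: eq_bigr => k _.
rewrite frob_ratioE !rmorphM /= !hornerM AE !geomE.
have h1 : 1 - gam k ^+ p != 0 by rewrite subr_eq0 eq_sym odd_root_expp_neq1.
have nE : 1 - gam k ^+ p ^+ n = (1 - gam k ^+ p) * geom n (gam k ^+ p).
  by rewrite -opprB subrX1 -mulNr opprB.
by rewrite [_ ^+ (p * n)]exprM nE geom_odd_root; field.
Qed.

End PowerOfPrime.

Section PrimeWeight.
Variables (R : realType) (m n p : nat) (q : int).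
Hypotheses (m_gt0 : (0 < m)%N) (p_pr : prime p) (p_odd : odd p).
Local Notation C := R[i]%C.

Lemma summand_modz l (g : C) : g ^+ m = -1 ->
   (p%:Z = q %[mod 2 * m%:Z])%Z \/ (p%:Z = - q %[mod 2 * m%:Z])%Z ->
   summand q l n g = summand p%:Z l n g.
Proof.
move=> gm.
have g0 : g != 0.
  apply/eqP => g0; move/eqP: gm.
  by rewrite g0 expr0n eqn0Ngt m_gt0 eq_sym oppr_eq0 oner_eq0.
have E (a b z : int) : a = b + z * (2 * m%:Z) -> forall c, g ^ (a * c) = g ^ (b * c).
  move=> -> c; rewrite mulrDl expfzDr //.
  rewrite (_ : z * _ * c = m%:Z * (2%:Z * (z * c))); last by ring.
  rewrite -(exprz_exp g m) -exprnP gm -(exprz_exp _ 2) -exprnP sqrrN expr1n.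
  by rewrite exp1rz mulr1.
have E1 (a b z : int) : a = b + z * (2 * m%:Z) -> g ^ a = g ^ b.
  by move=> /E /(_ 1); rewrite !mulr1.
have EN (a b z : int) : a = b + z * (2 * m%:Z) -> - a = - b + - z * (2 * m%:Z).
  by move=> ->; ring.
have modE (a b : int) : (a = b %[mod 2 * m%:Z])%Z -> exists z, a = b + z * (2 * m%:Z).
  move=> /eqP; rewrite eqz_mod_dvd => /dvdzP[z e]; exists z.
  by rewrite -e addrC subrK.
rewrite /summand; case=> /modE[z e].
  rewrite -!mulNr (E _ _ _ e) (E _ _ _ (EN _ _ _ e)).
  by rewrite (E1 _ _ _ e) (E1 _ _ _ (EN _ _ _ e)).
have := EN _ _ _ e; rewrite opprK => e'.
rewrite -!mulNr (E _ _ _ e) (E _ _ _ e') (E1 _ _ _ e) (E1 _ _ _ e').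
by congr (_ / _ * _); ring.
Qed.

(** 2 - h - 1/h = - (1 - h) ^ 2 / h, applied to h = g and to h = g ^ p; the
    factors - 1 / g ^ p cancel because p is odd. *)
Lemma summand_frob_ratio (g : C) : g != 0 -> g ^+ p != 1 ->
  summand p%:Z p n g = (2 - g ^+ p ^+ n - g ^- p ^+ n) * frob_ratio p g ^+ 2.
Proof.
move=> g0 h1; rewrite /summand /frob_ratio.
have -> : g ^ (p%:Z * n%:Z) = g ^+ p ^+ n by rewrite -exprz_exp -!exprnP.
have -> : g ^ (- (p%:Z * n%:Z)) = g ^- p ^+ n.
  by rewrite -mulNr -exprz_exp -exprnN -exprnP.
rewrite -exprnN -exprnP.
have -> : 2 - g - g^-1 = - ((1 - g) ^+ 2 / g) by field.
rewrite exprNn -signr_odd p_odd expr1 mulN1r expr_div_n [_ ^+ 2 ^+ p]exprAC.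
have gp0 : g ^+ p != 0 by rewrite expf_neq0.
have h1' : 1 - g ^+ p != 0 by rewrite subr_eq0 eq_sym.
move: (g ^+ p) ((1 - g) ^+ p) gp0 h1' => h b h0 h1'.
have -> : 2 - h - h^-1 = - ((1 - h) ^+ 2 / h) by field.
by field; rewrite h0 h1'.
Qed.

Lemma Vsum_prime : coprime p m -> ~~ (m %| n)%N ->
   (p%:Z = q %[mod 2 * m%:Z])%Z \/ (p%:Z = - q %[mod 2 * m%:Z])%Z ->
  exists W : int, Vsum R q p m n = ratr (1 + p%:R / m%:R *
    (2 * (\sum_(j < n) \sum_(i < p) frob_quot p i * root_trace m (j * p + i))%:~R
     + p%:R / 2 * W%:~R)).
Proof.
move=> pm mn pq; have [w wm] : exists w : C, (m.*2).-primitive_root w.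
  by apply: ex_prim_root; lia.
have [W We] := sum_frob_ratio_eq m_gt0 wm p_pr p_odd pm mn; exists W.
rewrite (Vsum_prim_root q p n m_gt0 wm).
under eq_bigr do rewrite (summand_modz _ (odd_root_expm m_gt0 wm _) pq)
  (summand_frob_ratio (odd_root_neq0 m_gt0 wm _) (odd_root_expp_neq1 m_gt0 wm p_odd _)).
rewrite (sum_frob_ratio m_gt0 wm) // We.
rewrite rmorphD rmorph1 rmorphM fmorph_div rmorphD 2!rmorphM.
rewrite fmorph_div /= !ratr_int !ratr_nat.
have m0 : (m%:R : C) != 0 by rewrite pnatr_eq0; lia.
by field.
Qed.

End PrimeWeight.

(** * Reduction modulo p *)

(** The power s ^ k stands for 1/s modulo p when k = p - 2; for k > 0 the term
    s = 0 vanishes. *)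
Definition alt_sum (k N : nat) : int := \sum_(s < N.+1) (-1) ^+ s * s%:Z ^+ k.

Lemma sum_nat_blocks (A : nmodType) (f : nat -> A) n d :
  \sum_(j < n) \sum_(i < d) f (j * d + i)%N = \sum_(t < n * d) f t.
Proof.
rewrite -[RHS](big_mkord xpredT) big_nat_mul big_mkord; apply: eq_bigr => j _.
rewrite -[X in \sum_(X <= _ < _) _]add0n big_addn mulSn addnK big_mkord.
by apply: eq_bigr => i _; rewrite addnC.
Qed.

Lemma sum_multiples (A : nmodType) (f : nat -> A) N m : (0 < m)%N ->
  ~~ (m %| N)%N -> (forall t, ~~ (m %| t)%N -> f t = 0) ->
  \sum_(t < N) f t = \sum_(s < (N %/ m).+1) f (s * m)%N.
Proof.
move=> m0 mN f0.
have Nlt : (N <= (N %/ m).+1 * m)%N by apply: ltnW; rewrite -ltn_divLR.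
(* No multiple of m lies between N and the end of the last block of length m. *)
transitivity (\sum_(t < (N %/ m).+1 * m) f t).
  rewrite -!(big_mkord xpredT) [RHS](big_cat_nat (n := N)) //=.
  rewrite [X in _ + X](_ : _ = 0) ?addr0 // big_nat big1 // => t /andP[Nt tN].
  apply: f0; apply: contraNN mN => /dvdnP[c tE].
  move: Nt tN; rewrite tE ltn_pmul2r // ltnS => Nc cN.
  have /eqP : (c * m = N)%N; last by move/eqP <-; exact: dvdn_mull.
  by apply/eqP; rewrite eqn_leq Nc andbT (leq_trans _ (leq_divM N m)) // leq_pmul2r.
rewrite -sum_nat_blocks; apply: eq_bigr => s _.
rewrite (bigD1 (Ordinal m0)) //= addn0 big1 ?addr0 // => i i0.
by apply: f0; rewrite dvdn_addr ?dvdn_mull // gtnNdvd // lt0n.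
Qed.

Section ModP.
Variable p : nat.
Hypothesis p_pr : prime p.

Lemma natFp0 : p%:R = 0 :> 'F_p.
Proof. by apply/eqP; rewrite -(dvdn_pcharf (pchar_Fp p_pr)). Qed.

Lemma intFp_eq0 (z : int) : (z%:~R == 0 :> 'F_p) = (p%:Z %| z)%Z.
Proof.
rewrite dvdzE; case: z => k /=.
  by rewrite -pmulrn (dvdn_pcharf (pchar_Fp p_pr)).
by rewrite NegzE mulrNz oppr_eq0 -pmulrn (dvdn_pcharf (pchar_Fp p_pr)).
Qed.

Lemma bin_pred_prime_Fp k : (k < p)%N -> 'C(p.-1, k)%:R = (-1) ^+ k :> 'F_p.
Proof.
elim: k => [|k IH] kp; first by rewrite bin0.
have /eqP : 'C(p, k.+1)%:R == 0 :> 'F_p.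
  by rewrite -(dvdn_pcharf (pchar_Fp p_pr)) prime_dvd_bin.
have -> : 'C(p, k.+1) = ('C(p.-1, k.+1) + 'C(p.-1, k))%N by case: (p) kp.
rewrite natrD IH 1?ltnW // => /eqP.
by rewrite addr_eq0 exprS mulN1r => /eqP.
Qed.

(** k * (C(p, k) / p) = C(p-1, k-1) for k > 0; at k = 0 both sides are 0. *)
Lemma frob_quot_Fp k : (k < p)%N -> (frob_quot p k)%:~R = - (k%:R)^-1 :> 'F_p.
Proof.
have p0 := prime_gt0 p_pr; rewrite /frob_quot.
case: k => [_|k kp].
  by rewrite bin0 divn_small ?prime_gt1 // mulr0 invr0 oppr0.
have E : (k.+1 * ('C(p, k.+1) %/ p) = 'C(p.-1, k))%N.
  apply/eqP; rewrite -(eqn_pmul2l p0) mul_bin_diag mulnCA [(p * _)%N]mulnC divnK //.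
  by rewrite prime_dvd_bin.
have k0 : k.+1%:R != 0 :> 'F_p.
  by rewrite -(dvdn_pcharf (pchar_Fp p_pr)) gtnNdvd.
apply: (mulfI k0); rewrite mulrN divff // intrM rmorph_sign mulrCA -pmulrn -natrM E.
by rewrite bin_pred_prime_Fp 1?ltnW // exprS -mulrA -expr2 sqrr_sign mulr1.
Qed.

Lemma Fp_inv_exp (k : nat) : (2 < p)%N -> (k%:R)^-1 = k%:R ^+ (p - 2) :> 'F_p.
Proof.
move=> p2; have [->|k0] := eqVneq (k%:R : 'F_p) 0.
  by rewrite invr0 expr0n; case: eqP => //; lia.
apply: (mulfI k0); rewrite divff // -exprS.
have := expf_card (k%:R : 'F_p); rewrite card_Fp // => e.
apply: (mulfI k0); rewrite mulr1 -exprS (_ : (p - 2).+2 = p) //; lia.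
Qed.

(** Put t = jp + k. Modulo p the coefficient A_k = -1/k is -1/t, so the double sum
    runs over all t < np with weight -1/t times [root_trace], and only t = s m
    survives: the weight of such a t is -(-1) ^ s m / (s m). *)
Lemma frob_trace_modp m n :
  (2 < p)%N -> (0 < m)%N -> coprime p m -> ~~ (m %| n)%N ->
  (p%:Z %| \sum_(j < n) \sum_(i < p) frob_quot p i * root_trace m (j * p + i)
     + alt_sum (p - 2) (n * p %/ m))%Z.
Proof.
move=> p2 m0 pm mn; rewrite -intFp_eq0 rmorphD /= addr_eq0; apply/eqP.
have mF : m%:R != 0 :> 'F_p.
  by rewrite -(dvdn_pcharf (pchar_Fp p_pr)) -prime_coprime.
pose f t : 'F_p := (t%:R)^-1 * (root_trace m t)%:~R.
transitivity (- \sum_(j < n) \sum_(i < p) f (j * p + i)%N).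
  rewrite -sumrN rmorph_sum /=; apply: eq_bigr => j _.
  rewrite -sumrN rmorph_sum /=; apply: eq_bigr => i _.
  by rewrite intrM frob_quot_Fp // /f natrD natrM natFp0 mulr0 add0r mulNr.
rewrite sum_nat_blocks (@sum_multiples _ f _ m) //.
- rewrite /alt_sum rmorph_sum /=; congr (- _); apply: eq_bigr => s _.
  rewrite /f /root_trace dvdn_mull // mulnK // !intrM rmorph_sign rmorphXn /= -!pmulrn.
  by rewrite natrM invfM -Fp_inv_exp // mulrCA -mulrA mulVf // mulr1.
- by rewrite mulnC Gauss_dvdr // coprime_sym.
- by move=> t mt; rewrite /f /root_trace (negPf mt) mulr0.
Qed.

(** Evaluating (1 - g) ^ p = 1 - g ^ p + p A(g) at g = -1. *)
Lemma fermat_quotient2 : odd p -> (2 < p)%N ->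
  exists D : int, 2 ^+ p - 2 = p%:Z * D /\ (p%:Z %| D + alt_sum (p - 2) p.-1)%Z.
Proof.
move=> p_odd p2; exists (\sum_(k < p) frob_quot p k * (-1) ^+ k); split.
  have := expr_1subr (-1 : int) p_pr p_odd.
  rewrite opprK -[in RHS]signr_odd p_odd expr1 opprK => ->.
  rewrite addrAC subrr add0r natz; congr (_ * _); apply: eq_bigr => k _.
  by rewrite intz.
rewrite -intFp_eq0 rmorphD /= addr_eq0 /alt_sum prednK ?prime_gt0 //; apply/eqP.
rewrite !rmorph_sum -sumrN /=; apply: eq_bigr => k _.
rewrite intrM frob_quot_Fp // intrM !rmorph_sign rmorphXn /= -pmulrn -Fp_inv_exp //.
by rewrite mulNr mulrC.
Qed.

End ModP.

(** * Euler polynomials *)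

(** The coefficient of z ^ k / k! in (e ^ z + 1) (sum of E_j z ^ j / j!)
    = 2 e ^ (Xz). *)
Lemma euler_bin_sum k :
  \sum_(j < k.+1) 'C(k, j)%:R *: euler j + euler k = 2 *: 'X^k.
Proof.
have /(congr1 ( *:%R k`!%:R)) := euler_gf k.
have fk0 i : (i`!%:R : rat) != 0 by rewrite pnatr_eq0 -lt0n fact_gt0.
rewrite fps_mulC [in RHS]/fps_exp -scalerAr scalerA divff // scale1r => e.
rewrite scaler_nat -mulr_natl -e /fps_mul scaler_sumr.
transitivity (\sum_(i < k.+1)
    ('C(k, i)%:R *: euler i + (i == ord_max)%:R *: euler i)).
  rewrite big_split /=; congr (_ + _).
  rewrite (bigD1 ord_max) //= eqxx scale1r big1 ?addr0 // => i.
  by move=> /negPf ->; rewrite scale0r.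
apply: eq_bigr => i _; have ik : (i <= k)%N by rewrite -ltnS.
rewrite [fps_add _ _ _]/fps_add /fps_exp /fps_one expr1n mulrDr [in RHS]scalerDr.
move: (euler i) => E; congr (_ + _).
  have := congr1 (fun n => n%:R : rat) (bin_fact ik); rewrite /= !natrM => <-.
  rewrite -scalerAl -scalerAr mulr1 !scalerA; congr (_ *: _).
  by field; rewrite !fk0.
have -> : ((k - i)%N == 0%N) = (i == ord_max).
  by rewrite subn_eq0 -val_eqE /= eqn_leq ik.
case: eqP => [->|_]; last by rewrite scale0r mulr0 scaler0.
by rewrite mulr1 scalerA divff.
Qed.

(** Both H_k = E_k(X+1) + E_k and 2 X ^ k satisfy
    (sum over j <= k of C(k, j) H_j) + H_k = 2 (X+1) ^ k + 2 X ^ k,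
    and such a system determines H_k recursively. *)
Lemma euler_shift k : euler k \Po ('X + 1) + euler k = 2 *: 'X^k.
Proof.
elim/ltn_ind: k => k IH.
have e0 := euler_bin_sum k.
have e1 := congr1 (fun P : {poly rat} => P \Po ('X + 1)) e0.
rewrite /= comp_polyD comp_polyZ comp_Xn_poly raddf_sum /= in e1.
have bX : \sum_(j < k.+1) 'C(k, j)%:R *: 'X^j = ('X + 1) ^+ k :> {poly rat}.
  rewrite addrC exprDn; apply: eq_bigr => j _.
  by rewrite expr1n mul1r scaler_nat.
have e2 : \sum_(j < k.+1) 'C(k, j)%:R *: (euler j \Po ('X + 1) + euler j)
    + (euler k \Po ('X + 1) + euler k) =
  \sum_(j < k.+1) 'C(k, j)%:R *: (2 *: 'X^j) + 2 *: 'X^k.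
  under [in RHS]eq_bigr do rewrite scalerA mulrC -scalerA.
  rewrite -scaler_sumr bX -e1 -e0.
  under [in LHS]eq_bigr do rewrite scalerDr.
  rewrite big_split /= addrACA; congr (_ + _ + _).
  by apply: eq_bigr => j _; rewrite comp_polyZ.
move: e2; rewrite !big_ord_recr /= binn !scale1r.
rewrite (eq_bigr (fun i : 'I_k => 'C(k, i)%:R *: (2 *: 'X^i))) => [|i _]; last first.
  by rewrite IH.
move: (euler k \Po ('X + 1) + euler k) (2 *: 'X^k) => H K.
rewrite -!addrA => /addrI; rewrite -!mulr2n -!scaler_nat.
by apply: scalerI.
Qed.

Lemma euler_horner_shift k x : (euler k).[x + 1] + (euler k).[x] = 2 * x ^+ k.
Proof.
have := congr1 (fun P : {poly rat} => P.[x]) (euler_shift k).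
by rewrite /= hornerD horner_comp !hornerE.
Qed.

(** Telescoping towards minus infinity: for odd k, the step from -N to -(N+1)
    adds 2 (-1) ^ (N+1) (-(N+1)) ^ k. This avoids the reflection formula that the
    usual evaluation at N+1 would call for. *)
Lemma euler_alt_sum k N : odd k ->
  (-1) ^+ N * (euler k).[- N%:R] - (euler k).[0] = - 2 * (alt_sum k N)%:~R.
Proof.
move=> ko; elim: N => [|N IH].
  rewrite /alt_sum big_ord1 oppr0 !mul1r subrr expr0n.
  by case: k ko => //= k _; rewrite mulr0.
have := euler_horner_shift k (- N.+1%:R).
rewrite {1}(_ : - N.+1%:R + 1 = - N%:R :> rat); last by rewrite -natr1; ring.
rewrite [(- N.+1%:R) ^+ k]exprNn -[(-1) ^+ k]signr_odd ko expr1 => e.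
rewrite /alt_sum big_ord_recr /= -/(alt_sum k N) intrD mulrDr -IH.
rewrite intrM rmorph_sign rmorphXn /= -pmulrn exprS.
have -> : (euler k).[- N.+1%:R] = 2 * (-1 * N.+1%:R ^+ k) - (euler k).[- N%:R].
  by rewrite -e; ring.
by ring.
Qed.

(** * Rational numbers with denominator prime to p *)

Section Integrality.
Variable p : nat.

Definition pintegral : {pred rat} := fun x => coprimez (denq x) p%:Z.

Lemma pintegralP x :
  reflect (exists2 b : int, coprimez b p%:Z & x * b%:~R \is a Num.int)
    (x \in pintegral).
Proof.
apply: (iffP idP) => [xp|[b bp xb]].
  exists (denq x) => //; rewrite -{1}[x]divq_num_den divfK ?intr_int //.
  by rewrite intr_eq0 denq_neq0.
apply: coprimez_dvdl bp.
have /intrP[z e] := xb.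
have e' : numq x * b = z * denq x.
  apply/eqP; rewrite -(eqr_int rat) !intrM -e -{2}[x]divq_num_den.
  by rewrite -mulrA mulrCA divfK ?intr_eq0 ?denq_neq0 // mulrC.
have : (denq x %| numq x * b)%Z by rewrite e' dvdz_mull.
rewrite Gauss_dvdzr // coprimez_sym /coprimez /gcdz.
by have := coprime_num_den x; rewrite /coprime => /eqP ->.
Qed.

Fact pintegral_subring : subring_closed pintegral.
Proof.
split.
- by apply/pintegralP; exists 1; rewrite ?mulr1 ?int_num1 // /coprimez gcd1z.
- move=> x y /pintegralP[a ap xa] /pintegralP[b bp yb]; apply/pintegralP.
  exists (a * b); first by rewrite coprimezMl ap bp.
  rewrite intrM mulrBl rpredB //; first by rewrite mulrA rpredM ?intr_int.
  by rewrite mulrCA rpredM ?intr_int.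
- move=> x y /pintegralP[a ap xa] /pintegralP[b bp yb]; apply/pintegralP.
  exists (a * b); first by rewrite coprimezMl ap bp.
  by rewrite intrM mulrACA rpredM.
Qed.

HB.instance Definition _ :=
  GRing.isSubringClosed.Build rat pintegral pintegral_subring.

Lemma pintegral_invn (b : nat) : coprime b p -> b%:R^-1 \in pintegral.
Proof.
move=> bp; apply/pintegralP; exists b%:Z => //.
have [->|b0] := eqVneq b 0%N; first by rewrite mulr0 int_num0.
by rewrite -pmulrn mulVf ?pnatr_eq0 // int_num1.
Qed.

(** [euler_bin_sum] expresses 2 E_k through X ^ k and the E_j with j < k, with
    integer coefficients; so only powers of 2 occur in the denominators. *)
Lemma euler_pintegral k : odd p -> euler k \is a polyOver pintegral.
Proof.
move=> p_odd; have half : (2%:R : rat)^-1 \in pintegral.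
  by apply: pintegral_invn; rewrite coprime2n.
elim/ltn_ind: k => k IH; have := euler_bin_sum k.
rewrite big_ord_recr /= binn scale1r -addrA -mulr2n => /eqP.
rewrite eq_sym -subr_eq => /eqP e.
have -> : euler k = 2^-1 *: (2 *: 'X^k - \sum_(i < k) 'C(k, i)%:R *: euler i).
  by rewrite -e opprB addrC subrK -[euler k *+ 2]scaler_nat scalerA mulVf ?scale1r.
rewrite polyOverZ // rpredB ?polyOverZ ?rpredX ?polyOverX ?rpred_nat //.
by apply: rpred_sum => i _; rewrite polyOverZ ?rpred_nat ?IH.
Qed.

Lemma pintegral_horner_diff (P : {poly rat}) x d :
  P \is a polyOver pintegral -> x \in pintegral -> d \in pintegral ->
  exists2 r, r \in pintegral & P.[x + p%:R * d] - P.[x] = p%:R * r.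
Proof.
move=> /polyOverP Pp xp dp; have yp : x + p%:R * d \in pintegral.
  by rewrite rpredD ?rpredM ?rpred_nat.
exists (\sum_(i < size P)
  P`_i * (d * \sum_(j < i) (x + p%:R * d) ^+ (i.-1 - j) * x ^+ j)).
  apply: rpred_sum => i _; rewrite !rpredM // rpred_sum // => j _.
  by rewrite rpredM ?rpredX.
rewrite !horner_coef -sumrB mulr_sumr; apply: eq_bigr => i _.
by rewrite -mulrBr subrXX addrAC subrr add0r !mulrA [P`_i * _]mulrC.
Qed.

End Integrality.

(** * The congruence *)

(** [euler_alt_sum] with N = p - 1 gives E(1-p) - E(0) = -2 times the alternating
    sum, while E(1-p) is congruent to E(1) = -E(0) modulo p. *)
Lemma euler0_fermat p (D : int) : prime p -> odd p -> (2 < p)%N ->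
  (p%:Z %| D + alt_sum (p - 2) p.-1)%Z ->
  exists2 r, r \in pintegral p & (euler (p - 2)).[0] + D%:~R = p%:R * r.
Proof.
move=> p_pr p_odd p2 /dvdzP[c Dc].
have ko : odd (p - 2) by lia.
have [r rp e1] := @pintegral_horner_diff p (euler (p - 2)) 1 (-1)
  (euler_pintegral _ p_odd) (rpred1 _) (rpredN1 _).
have e2 := euler_alt_sum p.-1 ko.
have e3 := euler_horner_shift (p - 2) 0.
have p0 := prime_gt0 p_pr.
rewrite (_ : 1 + p%:R * -1 = - p.-1%:R) in e1; last first.
  by rewrite -{1}(prednK p0) -natr1; ring.
rewrite add0r expr0n (_ : (p - 2 == 0)%N = false) ?mulr0 in e3; last by lia.
have sp : (-1) ^+ p.-1 = 1 :> rat by rewrite -signr_odd (_ : odd p.-1 = false) //; lia.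
rewrite sp mul1r in e2.
have Dc' := congr1 (fun z : int => z%:~R : rat) Dc.
rewrite intrD intrM /= in Dc'; rewrite -pmulrn in Dc'.
exists (2^-1 * r + c%:~R).
  rewrite rpredD ?rpred_int // rpredM // pintegral_invn //.
  by rewrite coprime2n.
move: e1 e2 e3 Dc'.
move: (euler (p - 2)).[0] (euler (p - 2)).[1] (euler (p - 2)).[- _].
move=> E0 E1 Ep e1 e2 e3 Dc'.
have -> : E0 = - E1 by apply/eqP; rewrite -addr_eq0 addrC e3.
by lra.
Qed.

Lemma floor_ratio (a m : nat) : (0 < m)%N ->
  Num.floor (a%:R / m%:R : rat) = (a %/ m)%N%:Z.
Proof.
move=> m0; have m0' : 0 < m%:R :> rat by rewrite ltr0n.
apply: floor_def; rewrite ler_pdivlMr // ltr_pdivrMr //.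
rewrite (_ : (a %/ m)%N%:Z + 1 = (a %/ m).+1%:Z); last by lia.
by rewrite -!pmulrn -!natrM ler_nat ltr_nat leq_divM -ltn_divLR /=.
Qed.

Lemma euler_vsum_congr (p m n : nat) (T W : int) :
  prime p -> odd p -> (0 < m)%N -> coprime p m ->
  (p%:Z %| T + alt_sum (p - 2) (n * p %/ m))%Z ->
  eq_modp p
    ((-1) ^ Num.floor (p%:R * n%:R / m%:R : rat)
        * (euler (p - 2)).[frac_part (p%:R * n%:R / m%:R)]
     + (2 ^+ p - 2) / p%:R)
    (2 * T%:~R + p%:R / 2 * W%:~R).
Proof.
move=> p_pr p_odd m0 pm /dvdzP[c Tc].
have p2 : (2 < p)%N by have := prime_gt1 p_pr; lia.
have ko : odd (p - 2) by lia.
have [D [D1 D2]] := fermat_quotient2 p_pr p_odd p2.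
have [r0 r0p e0] := euler0_fermat p_pr p_odd p2 D2.
have pR : (p%:R : rat) != 0 by rewrite pnatr_eq0; lia.
have mR : (m%:R : rat) != 0 by rewrite pnatr_eq0; lia.
rewrite -natrM /frac_part floor_ratio // [(p * n)%N]mulnC -exprnP -pmulrn.
have -> : (n * p)%:R / m%:R - (n * p %/ m)%:R
    = - (n * p %/ m)%:R + p%:R * (n%:R / m%:R) :> rat.
  by rewrite natrM; field.
move: (n * p %/ m)%N Tc (euler_alt_sum (n * p %/ m) ko) => F Tc eF.
have [r1 r1p e1] := @pintegral_horner_diff p (euler (p - 2)) (- F%:R) (n%:R / m%:R)
  (euler_pintegral _ p_odd) (rpredNr (rpred_nat _ _))
  (rpredM (rpred_nat _ _) (pintegral_invn (etrans (coprime_sym _ _) pm))).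
(* Up to multiples of p, the left side is (-1) ^ F E(-F) - E(0), which is -2 times
   the alternating sum, and so is -2T; the summands of the witness collect the
   multiples of p discarded in these four steps. *)
exists ((-1) ^+ F * r1 + r0 - 2 * c%:~R - 2^-1 * W%:~R); split; last first.
  have half : (2%:R : rat)^-1 \in pintegral p by rewrite pintegral_invn ?coprime2n.
  suff : (-1) ^+ F * r1 + r0 - 2 * c%:~R - 2^-1 * W%:~R \in pintegral p by [].
  by rewrite !(rpredB, rpredD, rpredM) ?rpredX ?rpredN ?rpred1 ?rpred_int ?rpred_nat.
have D1' := congr1 (fun z : int => z%:~R : rat) D1.
rewrite intrD intrM rmorphXn /= -[p%:~R]pmulrn in D1'.
have -> : (2 ^+ p - 2) / p%:R = D%:~R :> rat by rewrite D1' mulrC mulKf.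
move: e1 eF e0.
move: (euler _).[_ + _] (euler _).[- _] (euler _).[0] ((-1) ^+ F) => Ef EF E0 s.
move=> e1 eF e0.
have -> : Ef = EF + p%:R * r1 by rewrite -e1; ring.
have -> : T%:~R = c%:~R * p%:R - (alt_sum (p - 2) F)%:~R :> rat.
  by rewrite (_ : T = c * p%:Z - alt_sum (p - 2) F) ?rmorphB ?rmorphM //= -Tc addrK.
have -> : D%:~R = p%:R * r0 - E0 by rewrite -e0; ring.
have -> : s * (EF + p%:R * r1)
    = E0 + -2 * (alt_sum (p - 2) F)%:~R + s * (p%:R * r1).
  by rewrite -eF; ring.
by field.
Qed.

Lemma coprime_eq_modz (m p : nat) (q : int) : gcdz q m%:Z = 1 ->
  (p%:Z = q %[mod 2 * m%:Z])%Z \/ (p%:Z = - q %[mod 2 * m%:Z])%Z -> coprime p m.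
Proof.
move=> qm pq; suff : coprimez p%:Z m%:Z by [].
have red (a b : int) : (a = b %[mod 2 * m%:Z])%Z -> coprimez b m%:Z -> coprimez a m%:Z.
  move=> /eqP; rewrite eqz_mod_dvd => /dvdzP[z e].
  have -> : a = z * 2 * m%:Z + b by rewrite -mulrA -e subrK.
  by rewrite /coprimez [gcdz (_ + _) _]gcdzC gcdzMDl gcdzC.
case: pq => /red; apply; first exact/eqP.
by rewrite coprimeNz; apply/eqP.
Qed.

Theorem theorem1p3 (R : realType) (m n : nat) (q : int)
    (m_gt0 : (0 < m)%N) (n_gt0 : (0 < n)%N) (coprime_qm : gcdz q m%:Z = 1) :
  [/\ (forall i : nat, (0 < i <= m %/ 2)%N -> coef_a m i \is a Num.int) /\
      (forall j : nat, (1 <= j <= m.+1 %/ 2)%N -> coef_b m j \is a Num.int),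
      forall l : nat, (m %/ 2 <= l)%N ->
        Usum R q l m n =
        \sum_(1 <= i < (m %/ 2).+1)
          (-1) ^+ (i - 1) * ratr (coef_a m i) * Usum R q (l - i) m n,
      gcdz q (2 * m%:Z) = 1 ->
      forall l : nat, (m.+1 %/ 2 <= l)%N ->
        Vsum R q l m n =
        \sum_(1 <= j < (m.+1 %/ 2).+1)
          (-1) ^+ (j - 1) * ratr (coef_b m j) * Vsum R q (l - j) m n
    & ~~ (m %| n)%N ->
      forall p : nat, prime p -> odd p ->
        (p%:Z = q %[mod 2 * m%:Z])%Z \/ (p%:Z = - q %[mod 2 * m%:Z])%Z ->
        exists v : rat,
          Vsum R q p m n = ratr v /\
          eq_modp p
            ((-1) ^ Num.floor (p%:R * n%:R / m%:R : rat)
               * (euler (p - 2)).[frac_part (p%:R * n%:R / m%:R)]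
             + (2 ^+ p - 2) / p%:R)
            (m%:R / p%:R * (v - 1))].
Proof.
split.
- split=> i im; rewrite ?/coef_a ?/coef_b; case: ifP => m2.
  + by rewrite coef_cE //; lia.
  + by rewrite coef_dE //; lia.
  + by rewrite coef_dE //; lia.
  + by rewrite coef_cE.
- by move=> l; exact: Usum_recurrence.
- by move=> _ l; exact: Vsum_recurrence.
- move=> mn p p_pr p_odd pq; have pm := coprime_eq_modz coprime_qm pq.
  have p2 : (2 < p)%N by have := prime_gt1 p_pr; lia.
  have [W ->] := Vsum_prime R m_gt0 p_pr p_odd pm mn pq.
  eexists; split; first by [].
  rewrite addrAC subrr add0r mulrA (_ : m%:R / p%:R * _ = 1) ?mul1r.
    by apply: euler_vsum_congr => //; exact: frob_trace_modp.
  by field; rewrite !pnatr_eq0; lia.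
Qed.
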